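(* There is an absolute constant $C>0$ such that the following holds. Let $n\ge 2$ and let $w,v\in\mathbb{R}^n$ with $\Delta(v)>0$. Let $\overline{w}=n^{-1}\sum_{i=1}^n w_i$ and let $\sigma\ge 0$ be defined by $\sigma^2=\sum_{i=1}^n(w_i-\overline{w})^2$; assume $\sigma>0$. Let $\pi$ be a uniformly random permutation in $S_n$. Then for any closed interval $I\subset\mathbb{R}$ of length $|I|$, $$\mathbb{P}\left(w_\pi\cdot v\in I\right)\le C\left(\frac{|I|}{n\,\sigma\,\Delta(v)}\sqrt{\log n}+\frac{1}{n}\right).$$
   Context: For $v\in\mathbb{R}^n$, $\Delta(v)=\min_{i\ne j}|v_i-v_j|$. For a permutation $\pi\in S_n$, $w_\pi=(w_{\pi(1)},\dots,w_{\pi(n)})$, and $w_\pi\cdot v=\sum_{i=1}^n w_{\pi(i)}v_i$. Intervals are closed and bounded, of length $|I|\ge 0$ (a single point is an interval of length $0$). *)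

(* Defs.v *)
From mathcomp Require Import all_boot all_order all_algebra all_fingroup.
From mathcomp Require Import reals constructive_ereal exp.

Set Implicit Arguments.
Unset Strict Implicit.
Unset Printing Implicit Defensive.

Import Order.TTheory GRing.Theory Num.Theory.
Local Open Scope ring_scope.

(* The minimum is taken in \bar R, where +oo is neutral for min. It is finite as
   soon as n >= 2; for n <= 1 there are no pairs and Delta v = fine +oo = 0. *)
Definition Delta (R : realType) (n : nat) (v : 'rV[R]_n) : R :=
  fine (\big[Order.min/+oo%E]_(p : 'I_n * 'I_n | p.1 != p.2)
          (`|v 0 p.1 - v 0 p.2|)%:E).

Lemma Delta_is_min (R : realType) (n : nat) (v : 'rV[R]_n) :
  (2 <= n)%N ->
  (exists i j : 'I_n, i != j /\ Delta v = `|v 0 i - v 0 j|) /\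
  (forall i j : 'I_n, i != j -> Delta v <= `|v 0 i - v 0 j|).
Proof.
move=> n2; rewrite /Delta.
set F := fun p : 'I_n * 'I_n => (`|v 0 p.1 - v 0 p.2|)%:E.
pose p0 := (Ordinal (ltnW n2), Ordinal n2).
have [[i j] ij minE] := eq_bigmin p0 (fun p : 'I_n * 'I_n => p.1 != p.2) F
  isT (fun p _ => leey (F p)).
rewrite minE; split=> [|k l kl]; first by exists i, j.
by rewrite -lee_fin -/(F (k, l)) /= -[X in (X <= _)%E]minE; apply: bigmin_le_cond.
Qed.

Definition mean (R : realType) (n : nat) (w : 'rV[R]_n) : R :=
  n%:R^-1 * \sum_(i < n) w 0 i.

Definition sigma (R : realType) (n : nat) (w : 'rV[R]_n) : R :=
  Num.sqrt (\sum_(i < n) (w 0 i - mean w) ^+ 2).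

Definition dot (R : realType) (n : nat) (u v : 'rV[R]_n) : R :=
  \sum_(i < n) u 0 i * v 0 i.

(* Probability that a uniformly random element of T satisfies E. *)
Definition uniform_prob (R : realType) (T : finType) (E : pred T) : R :=
  #|E|%:R / #|T|%:R.

(* Main.v *)
Require Import Defs.
From mathcomp Require Import all_boot all_order all_algebra all_fingroup.
From mathcomp Require Import reals constructive_ereal exp.
From mathcomp Require Import ring lra zify.

Set Implicit Arguments.
Unset Strict Implicit.
Unset Printing Implicit Defensive.

Import Order.TTheory GRing.Theory Num.Theory.
Local Open Scope ring_scope.

(** The idea is a Stein-type identity for a flow of transpositions, in place of
    Fourier analysis.

    Write tau for the inverse of pi, so that the random sum is
    f(tau) = sum_x w_x v_(tau x): the value w_x sits at the position
    v_(tau x).  Suppose first that k of the values, forming the set A, exceed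
    all the others by at least d, and put m = N - k, where N is the number of
    values and k <= N / 256.  Exchange some a in A with the next element b outside A to the
    right of it.  This raises f by at least d Delta(v).  Let rho_a be the
    number of elements outside A to the left of a, and give the exchange the
    weight (rho_a + 1)(m - rho_a), as in the (m + 1)-dimensional irreducible
    representation of sl_2, where these products are those of the raising and
    lowering coefficients.  Then the flow into tau minus the flow out of it
    telescopes to h(tau) = sum_(a in A) (2 rho_a - m), whatever the relative
    order within A and within its complement.  Reindexing gives, for every
    function g of f,

      E [ sum of weights * (g(f(swapped tau)) - g(f(tau))) ] = E [ g(f) h ].

    Choose g nondecreasing with values in [0, 1] and slope
    1 / (2 d Delta sqrt k) on a window that starts with an interval I of
    length d Delta sqrt k.  Then the left side is at least
    P(f in I) * (typical total weight, about k N^2) / (2 sqrt k), while the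
    right side is at most E |h|, of order N sqrt k, because h is a centred
    linear rank statistic.  Hence P(f in I) = O(1 / N) ([few_hits_many]); the
    exceptional permutations that put half of A near the two ends of the line
    have probability at most 4^-k.  For k = 1 constant weights do the same
    with no exceptional event ([few_hits_one]).

    For general w, let M be a median.  Use only the k largest values and the
    values below M, and condition on the places of all the others
    ([average_ext]); N is still at least n / 2.  It remains to choose k.  If
    D_1 >= D_2 >= ... are the excesses over M, comparison with the harmonic
    series shows that a k with k D_k^2 >= c sigma^2 / log n exists; this is the
    only source of the factor sqrt (log n).  It can be taken equal to 1 or at
    least log n, since the k < log n together carry a small part of sigma^2 if
    D_1^2 < c sigma^2 / log n ([good_scale]).  In the second case
    4^-k <= 1 / n.  So some length r >= c sigma Delta(v) / sqrt (log n) has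
    concentration O(1 / n), and covering I by about |I| / r + 1 intervals of
    that length ends the proof. *)

(** * Counting the elements of a set below a point *)

Definition below (R : realFieldType) (T : finType) (z : T -> R) (D : {set T})
  (x : T) : nat := #|[set b in D | z b < z x]|.

Section Rank.
Variables (R : realFieldType) (T : finType) (z : T -> R) (D : {set T}).
Hypothesis z_inj : injective z.

Lemma leq_below x x' : z x <= z x' -> (below z D x <= below z D x')%N.
Proof.
move=> xx'; apply/subset_leq_card/subsetP => b; rewrite !inE => /andP[-> /=].
by move=> /lt_le_trans; apply.
Qed.

Lemma ltn_below b x : b \in D -> z b < z x -> (below z D b < below z D x)%N.
Proof.
move=> bD bx; apply/proper_card/properP; split.
  by apply/subsetP => c; rewrite !inE => /andP[-> /=] /lt_trans; apply.
by exists b; rewrite !inE bD //= ltxx.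
Qed.

Lemma below_le x : (below z D x <= #|D|)%N.
Proof. by apply/subset_leq_card/subsetP => b; rewrite !inE => /andP[]. Qed.

Lemma below_lt b : b \in D -> (below z D b < #|D|)%N.
Proof.
move=> bD; apply/proper_card/properP; split.
  by apply/subsetP => c; rewrite !inE => /andP[].
by exists b; rewrite // !inE ltxx andbF.
Qed.

Lemma below_inj : {in D &, injective (below z D)}.
Proof.
move=> b c bD cD eq_bc; case: (ltgtP (z b) (z c)) => [lt_bc|lt_cb|/z_inj //].
  by have := ltn_below bD lt_bc; rewrite eq_bc ltnn.
by have := ltn_below cD lt_cb; rewrite eq_bc ltnn.
Qed.

(** [below z D] numbers the elements of [D] by 0, 1, ..., #|D| - 1, which turns
    sums over [D] of functions of the rank into sums over an initial segment. *)
Lemma big_below (V : Type) (idx : V) (op : Monoid.com_law idx) (F : nat -> V) :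
  \big[op/idx]_(b in D) F (below z D b) = \big[op/idx]_(i < #|D|) F i.
Proof.
rewrite -(big_mkord xpredT F) /index_iota subn0 -big_enum /=.
rewrite -(big_map (below z D) xpredT F); apply: perm_big.
have u : uniq [seq below z D i | i <- enum D].
  rewrite map_inj_in_uniq ?enum_uniq // => b c.
  by rewrite !mem_enum; apply: below_inj.
apply: uniq_perm; rewrite ?iota_uniq //.
have [] // := uniq_min_size u (s2 := iota 0 #|D|).
  move=> i /mapP[b]; rewrite mem_enum => bD ->.
  by rewrite mem_iota /= add0n below_lt.
by rewrite size_iota size_map -cardE.
Qed.

End Rank.

(** * The Stein identity *)

(** The value 0 at rank 0 says that nothing flows in from below. *)
Definition shift1 (R : realFieldType) (f : nat -> R) (r : nat) : R :=
  if r is r'.+1 then f r' else 0.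

Section Stein.
Variables (R : realFieldType) (T : finType) (A : {set T}) (y : T -> R).
Hypothesis y_inj : injective y.

Local Notation D := (~: A).
Local Notation rho tau := (below (fun x => y (tau x)) D).
Local Notation swap tau a b := (tperm a b * tau)%g.

Lemma ytau_inj (tau : {perm T}) : injective (fun x => y (tau x)).
Proof. by move=> a b /y_inj /perm_inj. Qed.

(** As [a] is never counted by [rho], only the displacement of [b] matters in this
    lemma and the next; the boolean term says on which side of [a] it was. *)
Lemma below_swapl (tau : {perm T}) a b : a \in A -> b \notin A ->
  rho (swap tau a b) a = (rho tau b + (y (tau a) < y (tau b))%R)%N.
Proof.
move=> aA bA; have ab : a != b by apply: contraNneq bA => <-.
rewrite /below !permM tpermL (cardsD1 b) addnC; congr (_ + nat_of_bool _)%N; last first.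
  by rewrite !inE bA permM tpermR.
apply: eq_card => c; rewrite !inE permM.
have [->|cb] /= := eqVneq c b; first by rewrite ltxx andbF.
by case: (boolP (c \in A)) => //= cA; rewrite tpermD // eq_sym //;
  apply: contraNneq cA => ->.
Qed.

Lemma below_swapr (tau : {perm T}) a b : a \in A -> b \notin A ->
  (rho (swap tau a b) b + (y (tau b) < y (tau a))%R)%N = rho tau a.
Proof.
move=> aA bA; have ab : a != b by apply: contraNneq bA => <-.
rewrite /below !permM tpermR [RHS](cardsD1 b) addnC; congr (nat_of_bool _ + _)%N.
  by rewrite !inE bA.
apply: eq_card => c; rewrite !inE permM.
have [->|cb] /= := eqVneq c b; first by rewrite tpermR ltxx andbF.
by case: (boolP (c \in A)) => //= cA; rewrite tpermD // eq_sym //;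
  apply: contraNneq cA => ->.
Qed.

(** Equal ranks encode that [b] is the next element outside [A] to the right of
    [a]; if [b] were to the left, it would be counted for [a] and not for itself. *)
Lemma rho_eq_lt (tau : {perm T}) a b : a \in A -> b \notin A ->
  rho tau a = rho tau b -> y (tau a) < y (tau b).
Proof.
move=> aA bA e; case: (ltgtP (y (tau a)) (y (tau b))) => //.
  by move=> ba; have := @ltn_below R T (fun x => y (tau x)) D b a;
     rewrite inE bA e ltnn => /(_ isT ba).
by move=> /y_inj /perm_inj ab; move: bA; rewrite -ab aA.
Qed.

(** Reversal of the flow: [a] can have come from the place of [b] exactly when [b]
    is the last element outside [A] to the left of [a]. *)
Lemma swap_adjacent (tau : {perm T}) a b : a \in A -> b \notin A ->
  (rho (swap tau a b) a == rho (swap tau a b) b)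
    = ((rho tau b).+1 == rho tau a)
  /\ ((rho tau b).+1 = rho tau a -> rho (swap tau a b) a = rho tau b).
Proof.
move=> aA bA.
have E1 := below_swapl tau aA bA.
have E2 := below_swapr tau aA bA.
have bD : b \in D by rewrite inE.
case: (ltgtP (y (tau a)) (y (tau b))) => [lt_ab|lt_ba|].
- have := leq_below (z := fun x => y (tau x)) D (ltW lt_ab).
  move: E1 E2; rewrite lt_ab ltNge (ltW lt_ab) /= addn1 addn0 => -> -> le.
  split=> [|e]; last by rewrite -e ltnn in le.
  by rewrite !gtn_eqF // ltnS // (leq_trans le).
- move: E1 E2; rewrite lt_ba ltNge (ltW lt_ba) /= addn1 addn0 => -> <-.
  by split=> //; rewrite eqSS.
by move=> /y_inj /perm_inj ab; move: bA; rewrite -ab aA.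
Qed.

Variable beta : nat -> R.
(* An [a] to the right of all of [D] has no next element to be exchanged with. *)
Hypothesis beta_end : beta #|D| = 0.

(** The total weight is that of the unique next element, if there is one. *)
Lemma sum_next (tau : {perm T}) a (c : R) : (rho tau a = #|D| -> c = 0) ->
  \sum_(b in D | rho tau a == rho tau b) c = c.
Proof.
move=> c_end; rewrite big_mkcondr /=.
rewrite (big_below D (@ytau_inj tau) _ (fun i => if rho tau a == i then c else 0)).
have := below_le (fun x => y (tau x)) D a.
rewrite leq_eqVlt => /orP[/eqP e|lt_r].
  by rewrite c_end // big1 // => i _; case: ifP.
rewrite (bigD1 (Ordinal lt_r)) //= eqxx big1 ?addr0 // => i.
by rewrite -val_eqE eq_sym /= => /negPf->.
Qed.

(** Flow into [tau] minus flow out of it. *)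
Definition drift (tau : {perm T}) : R :=
  \sum_(a in A) (shift1 beta (rho tau a) - beta (rho tau a)).

(** Exchanging [a] and [b] is an involution of the permutations; reindexing the
    terms [G (swap tau a b)] along it turns differences of [G] into [G] times the
    net flow. *)
Lemma stein_identity (G : {perm T} -> R) :
  \sum_(tau : {perm T}) \sum_(a in A) \sum_(b in D | rho tau a == rho tau b)
     beta (rho tau a) * (G (swap tau a b) - G tau)
  = \sum_(tau : {perm T}) G tau * drift tau.
Proof.
have split_out (tau : {perm T}) a b : beta (rho tau a) * (G (swap tau a b) - G tau) =
   beta (rho tau a) * G (swap tau a b) - beta (rho tau a) * G tau by ring.
under eq_bigr do under eq_bigr do under eq_bigr do rewrite split_out.
under eq_bigr do under eq_bigr do rewrite sumrB.
under eq_bigr do rewrite sumrB.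
under [RHS]eq_bigr do rewrite mulr_sumr.
under [RHS]eq_bigr do under eq_bigr do rewrite mulrBr.
under [RHS]eq_bigr do rewrite sumrB.
rewrite !sumrB; congr (_ - _).
  rewrite exchange_big [RHS]exchange_big /=; apply: eq_bigr => a aA.
  under eq_bigr do rewrite big_mkcondr.
  rewrite exchange_big /=.
  transitivity (\sum_(b in D) \sum_(tau : {perm T})
     (if (rho tau b).+1 == rho tau a then G tau * beta (rho tau b) else 0)).
    apply: eq_bigr => b; rewrite inE => bA.
    rewrite (reindex_inj (mulgI (tperm a b))) /=; apply: eq_bigr => tau _.
    have [-> e] := swap_adjacent tau aA bA.
    case: eqP => // /e ->; rewrite mulrC; congr (G _ * _).
    by rewrite mulgA tperm2 mul1g.
  rewrite exchange_big /=; apply: eq_bigr => tau _.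
  rewrite (big_below D (@ytau_inj tau) _
    (fun i => if i.+1 == rho tau a then G tau * beta i else 0)).
  have := below_le (fun x => y (tau x)) D a; case: (rho tau a) => [_|r lt_r] /=.
    by rewrite big1 ?mulr0.
  rewrite (bigD1 (Ordinal lt_r)) //= eqxx big1 ?addr0 // => i.
  by rewrite -val_eqE eqSS /= => /negPf->.
apply: eq_bigr => tau _; apply: eq_bigr => a aA.
by rewrite sum_next 1?mulrC // => ->; rewrite beta_end mulr0.
Qed.

End Stein.

(** * From the identity to a bound on the hits of an interval *)

Section Ramp.
Variable R : realFieldType.
Implicit Types u : R.

Definition ramp u : R := Num.max 0 (Num.min 1 u).

Lemma ramp_ge0 u : 0 <= ramp u.
Proof. by rewrite le_max lexx. Qed.

Lemma ramp_le1 u : ramp u <= 1.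
Proof. by rewrite ge_max ler01 ge_min lexx. Qed.

Lemma ramp_mono u u' : u <= u' -> ramp u <= ramp u'.
Proof.
move=> uu'; rewrite /ramp ge_max le_max lexx /= le_max; apply/orP; right.
by rewrite le_min !ge_min lexx uu' orbT.
Qed.

Lemma ramp_id u : 0 <= u <= 1 -> ramp u = u.
Proof. by case/andP=> u0 u1; rewrite /ramp (min_idPr u1) (max_idPr u0). Qed.

(** The ramp is still rising above 1 / 2, so a step from its lower half is seen in
    full. *)
Lemma ramp_step (c u u' : R) : 0 <= u <= 2^-1 -> 0 <= c <= 2^-1 -> u + c <= u' ->
  c <= ramp u' - ramp u.
Proof.
case/andP=> u0 u1 /andP[c0 c1] uu'.
have := ramp_mono uu'; rewrite ramp_id; last by apply/andP; split; lra.
by rewrite (@ramp_id u); [lra | apply/andP; split; lra].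
Qed.

End Ramp.

Definition wsum (R : realFieldType) (T : finType) (w y : T -> R)
  (tau : {perm T}) : R := \sum_x w x * y (tau x).

Lemma wsum_swap (R : realFieldType) (T : finType) (w y : T -> R)
    (tau : {perm T}) a b : a != b ->
  wsum w y (tperm a b * tau)%g
    = wsum w y tau + (w a - w b) * (y (tau b) - y (tau a)).
Proof.
move=> ab; have ba : b != a by rewrite eq_sym.
have split2 (F : T -> R) : \sum_x F x = F a + F b + \sum_(x | (x != a) && (x != b)) F x.
  by rewrite (bigD1 a) //= (bigD1 b) //= addrA.
rewrite /wsum !split2 !permM tpermL tpermR.
under eq_bigr => i /andP[ia ib] do rewrite permM tpermD 1?eq_sym //.
by ring.
Qed.

Section SteinBound.
Variables (R : realFieldType) (T : finType) (A : {set T}) (w y : T -> R).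
Variables (d Dy : R).
Hypotheses (d_gt0 : 0 < d) (Dy_gt0 : 0 < Dy).
Hypothesis w_gap : forall a b, a \in A -> b \notin A -> d <= w a - w b.
Hypothesis y_gap : forall p q, y p < y q -> Dy <= y q - y p.
Hypothesis y_inj : injective y.

Local Notation D := (~: A).
Local Notation rho tau := (below (fun x => y (tau x)) D).
Local Notation swap tau a b := (tperm a b * tau)%g.

(** Equal ranks put [b] to the right of [a], so both factors of the increment are
    bounded below. *)
Lemma swap_gain (tau : {perm T}) a b : a \in A -> b \notin A ->
  rho tau a = rho tau b -> wsum w y tau + d * Dy <= wsum w y (swap tau a b).
Proof.
move=> aA bA e; have ab : a != b by apply: contraNneq bA => <-.
rewrite wsum_swap // lerD2l ler_pM // ?(ltW d_gt0) ?(ltW Dy_gt0) ?w_gap //.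
by apply/y_gap/(rho_eq_lt y_inj aA bA).
Qed.

Variable beta : nat -> R.
Hypothesis beta_end : beta #|D| = 0.
Hypothesis beta_ge0 : forall r, (r <= #|D|)%N -> 0 <= beta r.

(** The window has twice the length of the interval, so that every exchange from
    inside the interval gains at least 1 / (2 s). *)
Lemma stein_bound (s alpha : R) : 1 <= s ->
  \sum_(tau : {perm T} | alpha <= wsum w y tau <= alpha + d * Dy * s)
     \sum_(a in A) beta (rho tau a)
  <= 2 * s * \sum_(tau : {perm T}) `|drift A y beta tau|.
Proof.
move=> s1; set dl := d * Dy; have dl0 : 0 < dl by apply: mulr_gt0.
have s0 : 0 < s by lra.
pose r := 2 * (dl * s); have r0 : 0 < r by do 2!apply: mulr_gt0 => //.
(* [G] is the ramp that rises from 0 to 1 between [alpha] and [alpha + r]. *)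
pose U tau := (wsum w y tau - alpha) / r.
pose G tau := ramp (U tau).
have r_s : dl / r = (2 * s)^-1.
  by rewrite /r; field; rewrite !gt_eqF.
have step (tau : {perm T}) a b : a \in A -> b \notin A -> rho tau a = rho tau b ->
    U tau + (2 * s)^-1 <= U (swap tau a b).
  move=> aA bA e; rewrite -r_s /U -mulrDl ler_pM2r ?invr_gt0 //.
  by have := swap_gain aA bA e; rewrite -/dl; lra.
have c01 : 0 <= (2 * s)^-1 <= 2^-1.
  rewrite invr_ge0 mulr_ge0 ?(ltW s0) //= lef_pV2 ?posrE; lra.
have beta0 (tau : {perm T}) a : 0 <= beta (rho tau a).
  by apply/beta_ge0/below_le.
have out (tau : {perm T}) a :
    \sum_(b in D | rho tau a == rho tau b) beta (rho tau a) = beta (rho tau a).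
  by rewrite (sum_next y_inj) // => ->.
rewrite [leRHS]mulrC -ler_pdivrMr; last by apply: mulr_gt0.
apply: (@le_trans _ _ (\sum_(tau : {perm T}) G tau * drift A y beta tau)); last first.
  apply: ler_sum => tau _; apply: le_trans (ler_norm _) _.
  rewrite normrM ger0_norm ?ramp_ge0 // -[leRHS]mul1r.
  by rewrite ler_wpM2r ?normr_ge0 ?ramp_le1.
rewrite -(stein_identity y_inj beta_end G) mulr_suml big_mkcond /=.
apply: ler_sum => tau _; case: ifPn => [/andP[tau_l tau_u]|_]; last first.
  apply: sumr_ge0 => a aA; apply: sumr_ge0 => b /andP[]; rewrite inE => bA /eqP e.
  rewrite mulr_ge0 // subr_ge0 ramp_mono //.
  by apply: le_trans (step _ _ _ aA bA e); rewrite lerDl; case/andP: c01.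
rewrite mulr_suml; apply: ler_sum => a aA.
rewrite -{1}out mulr_suml; apply: ler_sum => b /andP[]; rewrite inE => bA /eqP e.
rewrite ler_wpM2l //; apply: ramp_step (step _ _ _ aA bA e) => //.
rewrite /U divr_ge0 ?subr_ge0 ?(ltW r0) //= ler_pdivrMr //.
by rewrite /r mulKf ?pnatr_eq0 // lerBlDl.
Qed.

End SteinBound.

(** * Linear statistics and prescribed landings of a uniform permutation *)

Section Uniform.
Variable T : finType.

Definition landing (E X : {set T}) : {set {perm T}} :=
  [set tau : {perm T} | [forall x in X, tau x \in E]].

Lemma landingU1 (E X : {set T}) a :
  landing E (a |: X) = [set tau in landing E X | tau a \in E].
Proof.
apply/setP => tau; rewrite !inE; apply/forall_inP/andP => [H|[/forall_inP H aE] x].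
  split; last by rewrite H ?setU11.
  by apply/forall_inP => x xX; rewrite H // setU1r.
by rewrite !inE => /predU1P[->//|/H].
Qed.

(** By symmetry all [x] outside [X] are equally likely to land in [E] together with
    [X], and exactly #|E| - #|X| of them do, once [X] has. *)
Lemma landing_step (E X : {set T}) a : a \notin X ->
  (#|landing E (a |: X)| * (#|T| - #|X|) = #|landing E X| * (#|E| - #|X|))%N.
Proof.
move=> aX.
have sym x : x \notin X -> #|landing E (x |: X)| = #|landing E (a |: X)|.
  move=> xX; rewrite -(card_preimset (landing E (a |: X)) (mulgI (tperm a x))).
  apply: eq_card => tau; rewrite !landingU1 !inE permM tpermL; congr (_ && _).
  apply: eq_forallb_in => z zX; rewrite permM tpermD //.
    by apply: contraNneq aX => ->.
  by apply: contraNneq xX => ->.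
transitivity (\sum_(x in ~: X) #|landing E (x |: X)|)%N.
  rewrite (eq_bigr (fun=> #|landing E (a |: X)|)) => [|x]; last by rewrite inE => /sym.
  by rewrite sum_nat_const [#|~: X|]cardsCs setCK mulnC.
transitivity (\sum_(tau in landing E X) \sum_(x in ~: X) (tau x \in E))%N; last first.
  rewrite (eq_bigr (fun=> (#|E| - #|X|)%N)) ?sum_nat_const // => tau.
  rewrite inE => /forall_inP H.
  rewrite -(card_preimset E (@perm_inj _ tau)) -sum1_card.
  have /setIidPr XE : X \subset tau @^-1: E by apply/subsetP => x /H; rewrite inE.
  rewrite sum1_card -{2}XE -cardsD -sum1_card big_mkcond [RHS]big_mkcond /=.
  by apply: eq_bigr => x _; rewrite !inE; do 2!case: (_ \in _).
rewrite exchange_big /=; apply: eq_bigr => x _.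
rewrite landingU1 -sum1_card big_mkcond [RHS]big_mkcond /=; apply: eq_bigr => tau _.
by rewrite !inE; case: [forall _ in _, _].
Qed.

Lemma card_landing (E X : {set T}) :
  (#|landing E X| * #|T| ^ #|X| <= #|E| ^ #|X| * #|{perm T}|)%N.
Proof.
move cX: #|X| => t; elim: t X cX => [|t IH] X cX.
  by rewrite !expn0 muln1 mul1n max_card.
have [a aX] : {a | a \in X} by apply/sigW/card_gt0P; rewrite cX.
have cX' : #|X :\ a| = t by have := cardsD1 a X; rewrite cX aX add1n => -[].
have aX' : a \notin X :\ a by rewrite !inE eqxx.
have := landing_step E aX'; rewrite setD1K // cX' => step.
have leE : (#|E| <= #|T|)%N by apply: max_card.
have lt_t : (t < #|T|)%N by rewrite -cX max_card.
have {}step : (#|landing E X| * #|T| <= #|landing E (X :\ a)| * #|E|)%N.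
  rewrite -(@leq_pmul2r (#|T| - t)) ?subn_gt0 // mulnAC step -!mulnA leq_mul2l.
  by apply/orP; right; rewrite mulnBl mulnBr leq_sub2l // mulnC leq_mul2l leE orbT.
have le_t := IH _ cX'.
rewrite !expnS mulnA; apply: leq_trans (leq_mul step (leqnn _)) _.
by rewrite mulnAC mulnC -[leqRHS]mulnA leq_mul2l le_t orbT.
Qed.

(** Union bound over the at most 2^k subsets [X] of [A] with at least half of its k
    elements: each lands in [E] with probability at most 64^-|X| <= 8^-k. *)
Lemma card_half_landing (E A : {set T}) : (64 * #|E| <= #|T|)%N ->
  (#|[set tau : {perm T} | #|A| <= 2 * #|[set a in A | tau a \in E]| ]| * 4 ^ #|A|
     <= #|{perm T}|)%N.
Proof.
move=> smallE; set k := #|A|; set P := #|{perm T}|.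
have [T0|T_gt0] := posnP #|T|.
  have -> : k = 0%N by apply/eqP; rewrite -leqn0 -T0 max_card.
  by rewrite muln1 max_card.
have one (X : {set T}) : (k <= 2 * #|X|)%N -> (#|landing E X| * 8 ^ k <= P)%N.
  move=> kX; apply: (@leq_trans (#|landing E X| * 64 ^ #|X|)).
    by rewrite leq_mul2l (_ : 64 = 8 ^ 2)%N // -expnM leq_pexp2l ?orbT.
  rewrite -(@leq_pmul2r (#|T| ^ #|X|)%N) ?expn_gt0 ?T_gt0 //.
  apply: (@leq_trans (64 ^ #|X| * (#|E| ^ #|X| * P))).
    by rewrite mulnAC mulnC leq_mul2l card_landing orbT.
  rewrite mulnA -expnMn mulnC leq_mul2l; apply/orP; right.
  by case: #|X| => // e; rewrite leq_exp2r.
set bad := [set tau | _].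
have cover : (#|bad| <= \sum_(X in powerset A | k <= 2 * #|X|) #|landing E X|)%N.
  rewrite -sum1_card; under [leqRHS]eq_bigr do rewrite -sum1_card big_mkcond.
  rewrite exchange_big /= big_mkcond /=; apply: leq_sum => tau _.
  case: ifP => // ; rewrite inE => kX.
  rewrite (bigD1 [set a in A | tau a \in E]) /=; last first.
    by rewrite kX andbT powersetE; apply/subsetP => a; rewrite inE => /andP[].
  rewrite ifT // inE; apply/forall_inP => a; rewrite inE => /andP[].
  by [].
rewrite -(@leq_pmul2r (2 ^ k)) ?expn_gt0 // -mulnA -expnMn.
apply: leq_trans (leq_mul cover (leqnn _)) _; rewrite big_distrl /=.
apply: (@leq_trans (\sum_(X in powerset A) P)); last first.
  by rewrite sum_nat_const card_powerset mulnC.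
rewrite [leqRHS](bigID (fun X : {set T} => (k <= 2 * #|X|)%N)) /=.
by apply: leq_trans (leq_addr _ _); apply: leq_sum => X /andP[_]; apply: one.
Qed.

Variables (R : realFieldType) (u : T -> R) (M : R).
Hypothesis u_sum : \sum_p u p = 0.
Hypothesis u_le : forall p, `|u p| <= M.

(** Sampling without replacement: as [u] sums to zero, distinct coordinates are
    negatively correlated. *)
Lemma second_moment (A : {set T}) :
  \sum_(tau : {perm T}) (\sum_(a in A) u (tau a)) ^+ 2
    <= #|A|%:R * M ^+ 2 * #|{perm T}|%:R.
Proof.
pose c a b := \sum_(tau : {perm T}) u (tau a) * u (tau b).
have c_le a : c a a <= M ^+ 2 * #|{perm T}|%:R.
  rewrite mulr_natr -sumr_const; apply: ler_sum => tau _.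
  rewrite -expr2 -real_normK ?num_real // ler_sqr ?nnegrE ?normr_ge0 //.
  exact: le_trans (normr_ge0 _) (u_le (tau a)).
have c_sym a b b' : a != b -> a != b' -> c a b = c a b'.
  move=> ab ab'; rewrite /c (reindex_inj (mulgI (tperm b b'))) /=.
  by apply: eq_bigr => tau _; rewrite !permM tpermL tpermD // eq_sym.
have c_neg a b : a != b -> c a b <= 0.
  move=> ab.
  have : \sum_x c a x = 0.
    rewrite exchange_big /= big1 // => tau _.
    by rewrite -mulr_sumr (reindex_inj (@perm_inj _ tau^-1%g)) /=
       (eq_bigr u) ?u_sum ?mulr0 // => p _; rewrite permKV.
  rewrite (bigD1 a) //= (eq_bigr (fun=> c a b)) => [|x xa]; last first.
    by apply: c_sym; rewrite // eq_sym.
  rewrite sumr_const => /eqP; rewrite addr_eq0 => /eqP ca.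
  have : 0 <= c a a by apply: sumr_ge0 => tau _; rewrite -expr2 sqr_ge0.
  rewrite ca oppr_ge0 pmulrn_lle0 //.
  by apply/card_gt0P; exists b; rewrite unfold_in eq_sym.
have -> : \sum_(tau : {perm T}) (\sum_(a in A) u (tau a)) ^+ 2
    = \sum_(a in A) \sum_(b in A) c a b.
  under eq_bigr do rewrite expr2 mulr_suml.
  rewrite exchange_big; apply: eq_bigr => a _ /=.
  under eq_bigr do rewrite mulr_sumr.
  by rewrite exchange_big.
rewrite -mulrA mulr_natl -sumr_const; apply: ler_sum => a aA.
rewrite (bigD1 a) //= -[leRHS]addr0 lerD //.
by apply: sumr_le0 => b /andP[_ ba]; rewrite c_neg // eq_sym.
Qed.

(** The inequality |h| <= M s / 2 + h^2 / (2 M s) stands in for Cauchy-Schwarz. *)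
Lemma first_moment (A : {set T}) (s : R) : 0 < s -> s ^+ 2 = #|A|%:R -> 0 < M ->
  \sum_(tau : {perm T}) `|\sum_(a in A) u (tau a)| <= M * s * #|{perm T}|%:R.
Proof.
move=> s0 sA M0; have Ms : 0 < M * s by rewrite mulr_gt0.
pose h (tau : {perm T}) := \sum_(a in A) u (tau a).
apply: (@le_trans _ _ (\sum_(tau : {perm T}) (M * s / 2 + h tau ^+ 2 / (2 * (M * s))))).
  apply: ler_sum => tau _; rewrite -/(h tau) -subr_ge0.
  have -> : M * s / 2 + h tau ^+ 2 / (2 * (M * s)) - `|h tau|
      = (M * s - `|h tau|) ^+ 2 / (2 * (M * s)).
    rewrite -(real_normK (num_real (h tau))); field.
    by rewrite gt_eqF // gt_eqF.
  by rewrite divr_ge0 ?sqr_ge0 // mulr_ge0 // ltW.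
rewrite big_split /= sumr_const -mulr_suml.
have -> : M * s * #|{perm T}|%:R = (M * s / 2) *+ #|{perm T}|
   + (#|A|%:R * M ^+ 2 * #|{perm T}|%:R) / (2 * (M * s)).
  rewrite -sA -mulr_natr; field; by rewrite gt_eqF // gt_eqF.
by rewrite lerD2l ler_pM2r ?second_moment // invr_gt0 mulr_gt0.
Qed.

End Uniform.

(** * Two separated groups of values *)

Lemma sum_ord_natr (R : realFieldType) n :
  \sum_(i < n) (2 * i%:R - (n%:R - 1)) = 0 :> R.
Proof.
rewrite sumrB sumr_const card_ord -mulr_sumr.
have -> : \sum_(i < n) i%:R = n%:R * (n%:R - 1) / 2 :> R.
  elim: n => [|n IH]; first by rewrite big_ord0 !mul0r.
  by rewrite big_ord_recr /= IH -[n.+1]addn1 natrD; field.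
by rewrite -mulr_natr; field.
Qed.

Lemma card_rank (R : realFieldType) (T : finType) (z : T -> R) (P : pred nat) :
  injective z ->
  #|[set p | P (below z [set: T] p)]| = (\sum_(i < #|T|) P i)%N.
Proof.
move=> z_inj; have := big_below [set: T] z_inj addn (fun i => nat_of_bool (P i)).
rewrite cardsT /= => <-.
by rewrite -sum1_card big_mkcond [RHS]big_mkcond; apply: eq_bigr => x _;
  rewrite !inE; case: (P _).
Qed.

Lemma sum_lt n q : (\sum_(i < n) (i < q)%N <= q)%N.
Proof.
have -> : (\sum_(i < n) (i < q) = minn n q)%N; last by rewrite geq_minr.
elim: n => [|n IH]; first by rewrite big_ord0 min0n.
by rewrite big_ord_recr /= IH; case: ltnP; lia.
Qed.

Section Finite.
Variables (R : realFieldType) (T : finType) (A : {set T}) (y : T -> R).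
Hypothesis y_inj : injective y.

Local Notation D := (~: A).
Local Notation rho tau := (below (fun x => y (tau x)) D).
Local Notation rk := (below y [set: T]).

Lemma rank_split (tau : {perm T}) x :
  (rho tau x + below (fun x => y (tau x)) A x)%N = rk (tau x).
Proof.
rewrite /below -[RHS](card_preimset _ (@perm_inj _ tau)) -[RHS](cardsID A) addnC.
by congr (_ + _)%N; apply: eq_card => p; rewrite !inE // andbC.
Qed.

Definition edge q : {set T} := [set p | (rk p < q)%N || (#|T| - q <= rk p)%N].

Lemma card_edge q : (#|edge q| <= 2 * q)%N.
Proof.
rewrite (card_rank (fun i => (i < q)%N || (#|T| - q <= i)%N) y_inj).
apply: (@leq_trans (\sum_(i < #|T|) (i < q) + \sum_(i < #|T|) (#|T| - q <= i))%N).
  rewrite -big_split /=; apply: leq_sum => i _.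
  by case: (i < q)%N; case: (#|T| - q <= i)%N.
rewrite mul2n -addnn leq_add ?sum_lt //.
rewrite (reindex_inj rev_ord_inj) /=; apply: leq_trans (sum_lt #|T| q).
apply: leq_sum => i _; suff -> : (#|T| - q <= #|T| - i.+1)%N = (i < q)%N by [].
by rewrite leq_sub2lE ?ltnS // (leq_trans (ltn_ord i)).
Qed.

(** The concave weight whose successive differences are linear, which makes the
    drift a linear rank statistic. *)
Definition parabola (r : nat) : R := r.+1%:R * (#|D|%:R - r%:R).

(** The drift is sum_a (2 rho_a - m).  Adding the pairs inside [A], whose
    contributions cancel, replaces rho_a by the rank of the position of [a]. *)
Lemma drift_parabola (tau : {perm T}) :
  drift A y parabola tau
    = \sum_(a in A) (2 * (rk (tau a))%:R - (#|T|%:R - 1)).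
Proof.
have term a : shift1 parabola (rho tau a) - parabola (rho tau a)
    = (2 * (rk (tau a))%:R - (#|T|%:R - 1)) -
      (2 * (below (fun x => y (tau x)) A a)%:R - (#|A|%:R - 1)).
  rewrite -rank_split -[#|T|](cardsC A) !natrD.
  by case: (rho tau a) => [|r]; rewrite /parabola /= -?[r.+1]addn1 -?[r.+2]addn1 ?natrD; ring.
rewrite /drift; under eq_bigr do rewrite term.
rewrite sumrB.
rewrite (big_below A (@ytau_inj _ _ _ y_inj tau) _
  (fun i => 2 * i%:R - (#|A|%:R - 1))).
by rewrite sum_ord_natr subr0.
Qed.

End Finite.

Section Bounds.
Variables (R : realFieldType) (T : finType) (A : {set T}) (w y : T -> R).
Variables (d Dy : R).
Hypotheses (d_gt0 : 0 < d) (Dy_gt0 : 0 < Dy).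
Hypothesis w_gap : forall a b, a \in A -> b \notin A -> d <= w a - w b.
Hypothesis y_gap : forall p q, y p < y q -> Dy <= y q - y p.
Hypothesis y_inj : injective y.

Local Notation D := (~: A).
Local Notation rho tau := (below (fun x => y (tau x)) D).
Local Notation rk := (below y [set: T]).
Local Notation N := #|T|.
Local Notation k := #|A|.
Local Notation hits alpha s :=
  [set tau : {perm T} | alpha <= wsum w y tau <= alpha + d * Dy * s].

(** Constant weights: the drift vanishes unless [a] is leftmost or rightmost, which
    has probability at most 2 / N, and only the rightmost place carries no weight. *)
Lemma few_hits_one (alpha : R) : k = 1%N ->
  #|hits alpha 1|%:R * N%:R <= 5 * #|{perm T}|%:R :> R.
Proof.
move=> k1; have [a Aa] : exists a, A = [set a] by apply/cards1P/eqP.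
pose beta r : R := (r < #|D|)%N%:R.
pose at_ r := [set tau : {perm T} | rho tau a == r].
have rho_a (tau : {perm T}) : rho tau a = rk (tau a).
  rewrite -(rank_split A) Aa (_ : below _ [set a] a = 0%N) ?addn0 // /below.
  by apply: eq_card0 => x; rewrite !inE; case: eqP => // ->; rewrite ltxx.
have at_le r : #|at_ r|%:R * N%:R <= #|{perm T}|%:R :> R.
  have -> : at_ r = landing [set p | rk p == r] A.
    apply/setP => tau; rewrite !inE rho_a Aa; apply/eqP/forall_inP => [e x|].
      by rewrite !inE => /eqP->; apply/eqP.
    by move=> /(_ a); rewrite !inE eqxx => /(_ isT) /eqP.
  rewrite -natrM ler_nat; have := card_landing [set p | rk p == r] A.
  rewrite k1 !expn1 => /leq_trans; apply; rewrite -[leqRHS]mul1n leq_mul2r; apply/orP; right.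
  rewrite (card_rank (fun i => i == r) y_inj).
  elim: #|T| => [|n IH]; first by rewrite big_ord0.
  rewrite big_ord_recr /=; case: eqP => [<-|_]; last by rewrite addn0.
  by rewrite big1 // => i _; rewrite ltn_eqF.
have beta_end : beta #|D| = 0 by rewrite /beta ltnn.
have stein := stein_bound d_gt0 Dy_gt0 w_gap y_gap y_inj beta_end
  (fun r _ => ler0n R (r < #|D|)%N) alpha (lexx 1).
rewrite mulr1 in stein.
have card_at r : #|at_ r|%:R = \sum_(tau : {perm T}) (rho tau a == r)%:R :> R.
  by rewrite -sum1_card natr_sum big_mkcond; apply: eq_bigr => tau _; rewrite inE; case: eqP.
have drift_le : \sum_(tau : {perm T}) `|drift A y beta tau|
    <= #|at_ 0%N|%:R + #|at_ #|D| |%:R :> R.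
  rewrite !card_at -big_split /=.
  apply: ler_sum => tau _; rewrite /drift Aa big_set1 -Aa.
  have := below_le (fun x => y (tau x)) D a; rewrite leq_eqVlt /beta.
  case: (rho tau a) => [|r] /=.
    by move=> _; case: (0 < #|D|)%N; rewrite sub0r normrN ?normr1 ?normr0 ?lerDl ?addr_ge0.
  case: eqP => [<-|_ /= lt_r]; first by rewrite leqnn ltnn subr0 normr1 add0r.
  by rewrite lt_r (ltnW lt_r) subrr normr0 addr0.
have hits_le : #|hits alpha 1|%:R <=
    \sum_(tau : {perm T} | alpha <= wsum w y tau <= alpha + d * Dy)
      \sum_(a in A) (rho tau a < #|D|)%N%:R + #|at_ #|D| |%:R :> R.
  rewrite card_at [X in _ <= X + _]big_mkcond -big_split /=.
  rewrite -[#|hits alpha 1|]sum1_card natr_sum big_mkcond /=; apply: ler_sum => tau _.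
  rewrite !inE mulr1 Aa big_set1 -Aa; have := below_le (fun x => y (tau x)) D a.
  rewrite leq_eqVlt; case: eqP => _ /=; last by move=> ->; rewrite addr0.
  by case: ifP => _ _; rewrite ?lerDr ?add0r.
have N0 : 0 <= N%:R :> R by [].
have : #|hits alpha 1|%:R <= 2 * (#|at_ 0%N|%:R + #|at_ #|D| |%:R) + #|at_ #|D| |%:R :> R by lra.
move=> /(ler_wpM2r N0) /le_trans; apply.
have := at_le 0%N; have := at_le #|D|; lra.
Qed.

(** Outside the exceptional event, more than half of [A] is away from the ends
    and the total weight is of order k N^2, against a drift of order N sqrt k. *)
Lemma few_hits_many (alpha s : R) : 1 <= s -> s ^+ 2 = k%:R ->
    (256 * k <= N)%N ->
  #|hits alpha s|%:R <= (2 ^+ 20 / N%:R + 4 ^- k) * #|{perm T}|%:R :> R.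
Proof.
move=> s1 sk kN; set P := #|{perm T}|; pose q := (N %/ 128)%N.
have s0 : 0 < s by lra.
have k0 : (0 < k)%N by rewrite -(ltr_nat R) -sk exprn_gt0.
have kq : (2 * k <= q)%N by rewrite /q leq_divRL //; lia.
have N0 : (0 < N)%N by lia.
have qN : (N <= 256 * q)%N
  by rewrite /q; have := divn_eq N 128; have := ltn_pmod N (isT : (0 < 128)%N); lia.
(* As 2 q <= N / 64, the tail bound applies to the [edge] positions; as 2 k <= q,
   at every other position rho + 1 and m - rho are both at least q / 2. *)
pose bad := [set tau : {perm T} | k <= 2 * #|[set a in A | tau a \in edge y q]| ]%N.
have bad_le : #|bad|%:R <= 4 ^- k * P%:R :> R.
  have E64 : (64 * #|edge y q| <= N)%N.
    by have := card_edge y_inj q; have := leq_trunc_div N 128; rewrite -/q; lia.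
  rewrite mulrC ler_pdivlMr ?exprn_gt0 // -natrX -natrM ler_nat.
  exact: card_half_landing.
have par_ge0 r : (r <= #|D|)%N -> 0 <= parabola R A r.
  by move=> rD; rewrite mulr_ge0 // subr_ge0 ler_nat.
have par_end : parabola R A #|D| = 0 by rewrite /parabola subrr mulr0.
have stein := stein_bound d_gt0 Dy_gt0 w_gap y_gap y_inj par_end par_ge0 alpha s1.
have drift_le : \sum_(tau : {perm T}) `|drift A y (parabola R A) tau| <= N%:R * s * P%:R.
  under eq_bigr do rewrite (drift_parabola A y_inj).
  apply: (@first_moment T R (fun p => 2 * (rk p)%:R - (N%:R - 1))) => //; last by rewrite ltr0n.
    have := big_below [set: T] y_inj +%R (fun i => 2 * i%:R - (N%:R - 1) : R).
    rewrite cardsT sum_ord_natr => E; rewrite -[RHS]E.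
    by apply: eq_bigl => p; rewrite inE.
  move=> p; have : (rk p < N)%N by rewrite -cardsT below_lt // inE.
  rewrite -(ltr_nat R) => lt_rk; rewrite ler_norml; have := ler0n R (rk p).
  have : (rk p)%:R + 1 <= N%:R :> R by rewrite natr1 ler_nat -(ltr_nat R).
  by move=> *; apply/andP; split; lra.
have mid (tau : {perm T}) a : a \in A -> tau a \notin edge y q ->
    (q%:R / 2) ^+ 2 <= parabola R A (rho tau a).
  move=> aA; rewrite inE negb_or -leqNgt -ltnNge => /andP[rk_l rk_u].
  have split_a := rank_split A y tau a.
  have lt_A := below_lt (fun x => y (tau x)) aA.
  have cA := cardsC A.
  have half (x : nat) : (q <= 2 * x)%N -> q%:R / 2 <= x%:R :> R.
    by rewrite -(ler_nat R) natrM; lra.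
  have rho_le := below_le (fun x => y (tau x)) D a.
  rewrite expr2 /parabola -natrB //; apply: ler_pM; rewrite ?divr_ge0 //; apply: half; lia.
have main : #|hits alpha s :\: bad|%:R * (k%:R / 2 * (q%:R / 2) ^+ 2)
    <= 2 * s * (N%:R * s * P%:R) :> R.
  apply: le_trans (ler_wpM2l _ drift_le); last by lra.
  apply: le_trans stein; rewrite mulr_natl -sumr_const.
  rewrite [leLHS]big_mkcond [leRHS]big_mkcond /=; apply: ler_sum => tau _.
  rewrite !inE andbC; case: ifPn => [/andP[-> few]|_]; last first.
    case: ifP => // _; apply: sumr_ge0 => a aA; exact/par_ge0/below_le.
  rewrite (bigID (fun a => tau a \in edge y q)) /= -[leLHS]add0r lerD //.
    by apply: sumr_ge0 => a aA; exact/par_ge0/below_le.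
  apply: le_trans (_ : \sum_(a in A | tau a \notin edge y q) (q%:R / 2) ^+ 2 <= _); last first.
    by apply: ler_sum => a /andP[aA]; apply: mid.
  rewrite sumr_const -[leRHS]mulr_natl ler_wpM2r ?sqr_ge0 //.
  have : (k < 2 * #|[pred a | (a \in A) && (tau a \notin edge y q)]|)%N.
    set e := #|[pred a | _]|; have kE : k = (#|[set a in A | tau a \in edge y q]| + e)%N.
      rewrite -(cardsID [set a | tau a \in edge y q] A); congr (_ + _)%N.
        by apply: eq_card => a; rewrite !inE.
      by rewrite /e; apply: eq_card => a; rewrite !inE andbC.
    by move: few; rewrite -ltnNge kE mul2n -addnn ltn_add2l mul2n -addnn ltn_add2r.
  by rewrite -(ltr_nat R) natrM; lra.
have good_le : #|hits alpha s :\: bad|%:R <= 2 ^+ 20 / N%:R * P%:R :> R.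
  rewrite (mulrAC _ _ P%:R) ler_pdivlMr ?ltr0n //.
  have kR : 0 < k%:R :> R by rewrite ltr0n.
  have NR : 0 < N%:R :> R by rewrite ltr0n.
  have qR : N%:R <= 256 * q%:R :> R by rewrite -natrM ler_nat.
  have q2 : N%:R ^+ 2 <= (256 * q%:R) ^+ 2 :> R by rewrite ler_sqr ?nnegrE ?ler0n // mulr_ge0.
  set h := #|_|%:R in main *; have h0 : 0 <= h by rewrite ler0n.
  rewrite -(@ler_pM2r _ (k%:R * N%:R)) ?mulr_gt0 //.
  apply: (@le_trans _ _ (h * k%:R * (256 * q%:R) ^+ 2)).
    have -> : h * N%:R * (k%:R * N%:R) = h * k%:R * N%:R ^+ 2 by ring.
    by rewrite ler_wpM2l // mulr_ge0.
  have -> : h * k%:R * (256 * q%:R) ^+ 2 = 2 ^+ 19 * (h * (k%:R / 2 * (q%:R / 2) ^+ 2)) by field.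
  apply: le_trans (ler_wpM2l _ main) _; first by rewrite exprn_ge0.
  rewrite -sk le_eqVlt; apply/orP; left; apply/eqP; ring.
rewrite mulrDl; apply: le_trans (lerD good_le bad_le).
rewrite -natrD ler_nat -(cardsID bad (hits _ _)) addnC leq_add2l.
by apply/subset_leq_card/subsetIr.
Qed.
End Bounds.

(** * Conditioning on the places of all other values *)

Section Extend.
Variables (T : finType) (E : {set T}).
Local Notation U := {x : T | x \in E}.

Definition ext_fun (sig : {perm U}) (x : T) : T :=
  if insub x is Some u then val (sig u) else x.

Lemma ext_fun_in sig (u : U) : ext_fun sig (val u) = val (sig u).
Proof. by rewrite /ext_fun valK. Qed.

Lemma ext_fun_out sig x : x \notin E -> ext_fun sig x = x.
Proof. by move=> xE; rewrite /ext_fun insubN. Qed.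

Lemma ext_fun_inj sig : injective (ext_fun sig).
Proof.
move=> x x'; have [xE|xE] := boolP (x \in E); have [xE'|xE'] := boolP (x' \in E).
- rewrite -[x]/(val (exist _ x xE : U)) -[x']/(val (exist _ x' xE' : U)) !ext_fun_in.
  by move=> /val_inj /perm_inj ->.
- rewrite -[x]/(val (exist _ x xE : U)) ext_fun_in ext_fun_out // => e.
  by move: xE'; rewrite -e (valP (sig _)).
- rewrite -[x']/(val (exist _ x' xE' : U)) ext_fun_in ext_fun_out // => e.
  by move: xE; rewrite e (valP (sig _)).
by rewrite !ext_fun_out.
Qed.

Definition ext sig : {perm T} := perm (@ext_fun_inj sig).

(** For every fixed [sig], [tau0 |-> ext sig * tau0] is a bijection, so a bound on
    all fibres averages to a bound on all permutations. *)
Lemma average_ext (R : realFieldType) (P : pred {perm T}) (c : R) :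
  (forall tau0, #|[set sig : {perm U} | P (ext sig * tau0)%g]|%:R
                  <= c * #|{perm U}|%:R) ->
  #|[set tau | P tau]|%:R <= c * #|{perm T}|%:R.
Proof.
move=> fibre; have U0 : 0 < #|{perm U}|%:R :> R.
  by rewrite ltr0n; apply/card_gt0P; exists 1%g.
rewrite -(ler_pM2r U0) -natrM mulnC mulrAC.
have -> : (#|{perm U}| * #|[set tau | P tau]| =
   \sum_(tau0 : {perm T}) #|[set sig : {perm U} | P (ext sig * tau0)%g]|)%N.
  transitivity (\sum_(sig : {perm U}) #|[set tau | P tau]|)%N.
    by rewrite sum_nat_const.
  under [RHS]eq_bigr do rewrite -sum1_card big_mkcond.
  rewrite exchange_big /=; apply: eq_bigr => sig _.
  rewrite -sum1_card big_mkcond /= (reindex_inj (mulgI (ext sig))) /=.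
  by apply: eq_bigr => tau0 _; rewrite !inE.
rewrite natr_sum [leRHS]mulr_natr -sumr_const.
by apply: ler_sum => tau0 _; apply: fibre.
Qed.

Lemma wsum_ext (R : realFieldType) (w y : T -> R) (sig : {perm U}) (tau0 : {perm T}) :
  wsum w y (ext sig * tau0)%g
    = \sum_(x in ~: E) w x * y (tau0 x)
      + wsum (fun u : U => w (val u)) (fun u : U => y (tau0 (val u))) sig.
Proof.
rewrite /wsum (bigID (mem E)) /= addrC; congr (_ + _).
  apply: eq_big => [x|x xE]; first by rewrite inE.
  by rewrite permM permE ext_fun_out.
by rewrite big_sub; apply: eq_bigr => u _; rewrite permM permE ext_fun_in.
Qed.

End Extend.

Section TwoLevels.
Variables (R : realFieldType) (T : finType) (A B : {set T}) (w y : T -> R).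
Variables (d Dy : R).
Hypotheses (d_gt0 : 0 < d) (Dy_gt0 : 0 < Dy).
Hypothesis w_gap : forall a b, a \in A -> b \in B -> d <= w a - w b.
Hypothesis y_gap : forall p q, y p < y q -> Dy <= y q - y p.
Hypothesis y_inj : injective y.
Hypothesis B_half : (#|T| <= 2 * #|B|)%N.

Local Notation U := {x : T | x \in A :|: B}.
Let AU : {set U} := [set u | val u \in A].

Lemma card_AU : #|AU| = #|A|.
Proof.
rewrite -(card_imset _ val_inj); apply: eq_card => x; apply/imsetP/idP.
  by case=> u; rewrite inE => uA ->.
move=> xA; have xE : x \in A :|: B by rewrite inE xA.
by exists (exist _ x xE : U); rewrite ?inE.
Qed.

Lemma card_U : (#|T| <= 2 * #|{: U}|)%N.
Proof.
rewrite card_sig (leq_trans B_half) // leq_mul2l /=.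
by apply/subset_leq_card/subsetP => x; rewrite !inE => ->; rewrite orbT.
Qed.

Lemma w_gapU (a b : U) : a \in AU -> b \notin AU -> d <= w (val a) - w (val b).
Proof.
rewrite !inE => aA bA; apply: w_gap => //.
by have := valP b; rewrite inE (negPf bA).
Qed.

Section Fibre.
Variables (tau0 : {perm T}).
Lemma y_gapU (p q : U) : y (tau0 (val p)) < y (tau0 (val q)) ->
  Dy <= y (tau0 (val q)) - y (tau0 (val p)).
Proof. exact: y_gap. Qed.

Lemma y_injU : injective (fun u : U => y (tau0 (val u))).
Proof. by move=> p q /y_inj /perm_inj /val_inj. Qed.
End Fibre.

Lemma two_level_one (alpha : R) : #|A| = 1%N ->
  #|[set tau | alpha <= wsum w y tau <= alpha + d * Dy]|%:R
    <= 10 / #|T|%:R * #|{perm T}|%:R :> R.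
Proof.
move=> A1; apply: (@average_ext _ (A :|: B)) => tau0.
set sh := \sum_(x in ~: (A :|: B)) w x * y (tau0 x).
have := few_hits_one d_gt0 Dy_gt0 w_gapU (@y_gapU tau0) (@y_injU tau0) (alpha - sh).
rewrite card_AU => /(_ A1).
set H := [set _ | _]; have -> : H = [set sig : {perm U} |
    alpha <= wsum w y (ext sig * tau0)%g <= alpha + d * Dy].
  apply/setP => sig; rewrite !inE wsum_ext -/sh mulr1.
  by rewrite lerBlDl -addrAC lerBrDl.
have T0 : (0 < #|T|)%N by rewrite (leq_trans _ (max_card (mem A))) // A1.
set h := #|_|%:R; set P := #|{perm U}|%:R => H1.
rewrite mulrAC ler_pdivlMr ?ltr0n //.
have h0 : 0 <= h by rewrite /h ler0n.
have : h * #|T|%:R <= h * (2 * #|{: U}|%:R).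
  by rewrite ler_wpM2l // -natrM ler_nat card_U.
by lra.
Qed.

Lemma two_level_many (alpha s : R) : 1 <= s -> s ^+ 2 = #|A|%:R ->
    (512 * #|A| <= #|T|)%N ->
  #|[set tau | alpha <= wsum w y tau <= alpha + d * Dy * s]|%:R
    <= (2 ^+ 21 / #|T|%:R + 4 ^- #|A|) * #|{perm T}|%:R :> R.
Proof.
move=> s1 sA AT; apply: (@average_ext _ (A :|: B)) => tau0.
set sh := \sum_(x in ~: (A :|: B)) w x * y (tau0 x).
have := few_hits_many d_gt0 Dy_gt0 w_gapU (@y_gapU tau0) (@y_injU tau0) (alpha - sh) s1.
have AU2 : (256 * #|A| <= #|{: U}|)%N by have := card_U; lia.
rewrite card_AU => /(_ sA AU2).
set H := [set _ | _]; have -> : H = [set sig : {perm U} |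
    alpha <= wsum w y (ext sig * tau0)%g <= alpha + d * Dy * s].
  apply/setP => sig; rewrite !inE wsum_ext -/sh.
  by rewrite lerBlDl -addrAC lerBrDl.
move=> /le_trans; apply; rewrite ler_wpM2r ?ler0n // lerD2r.
have A0 : (0 < #|A|)%N by rewrite -(ltr_nat R) -sA exprn_gt0 //; lra.
have U0 : (0 < #|{: U}|)%N by lia.
have T0 : (0 < #|T|)%N by lia.
rewrite ler_pdivrMr ?ltr0n // mulrAC ler_pdivlMr ?ltr0n //.
have : #|T|%:R <= 2 * #|{: U}|%:R :> R by rewrite -natrM ler_nat card_U.
by lra.
Qed.

End TwoLevels.

(** * Choice of the scale *)

Section Log.
Variable R : realType.

(** From ln (1 + x) <= x at x = - 1 / 2, which gives ln 2 >= 1 / 2. *)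
Lemma ln_ge_half n : (2 <= n)%N -> 1 <= 2 * ln n%:R :> R.
Proof.
move=> n2; have ln2 : 1 <= 2 * ln 2 :> R.
  have := @le_ln1Dx R (- 2^-1).
  have -> : 1 + - 2^-1 = 2^-1 :> R by lra.
  by rewrite lnV ?posrE //; lra.
apply: le_trans ln2 _; rewrite ler_pM2l // ler_ln ?posrE ?ler_nat //.
by rewrite ltr0n (leq_trans _ n2).
Qed.

(** From ln (1 + x) <= x at x = - 1 / (n + 2). *)
Lemma harmonic_le_ln n : \sum_(i < n.+1) i.+1%:R^-1 <= 1 + ln n.+1%:R :> R.
Proof.
elim: n => [|n IH]; first by rewrite big_ord1 invr1 ln1 addr0.
rewrite big_ord_recr /=; apply: le_trans (lerD IH (lexx _)) _.
rewrite -addrA lerD2l -lerBrDl.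
have n0 : 0 < n.+1%:R :> R by rewrite ltr0n.
have n1 : 0 < n.+2%:R :> R by rewrite ltr0n.
have := @le_ln1Dx R (- n.+2%:R^-1).
have -> : 1 + - n.+2%:R^-1 = n.+1%:R / n.+2%:R :> R.
  apply: (mulIf (lt0r_neq0 n1)); rewrite mulfVK ?lt0r_neq0 //.
  by rewrite mulrDl mul1r mulNr mulVf ?lt0r_neq0 // -[n.+2]addn1 natrD addrK.
by rewrite ln_div ?posrE // ltrN2 invf_lt1 // ltr1n => /(_ isT); rewrite lerNr opprB.
Qed.

Lemma sum_indic_le (X : R) n : 0 <= X -> \sum_(i < n) (i.+1%:R <= X)%R%:R <= X.
Proof.
move=> X0; elim: n => [|n IH]; first by rewrite big_ord0.
rewrite big_ord_recr /=; have [nX|_] := leP n.+1%:R X; last by rewrite mulr0n addr0.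
apply: le_trans nX; rewrite mulr1n -natr1 lerD2r.
apply: le_trans (_ : \sum_(i < n) 1 <= _); last by rewrite sumr_const card_ord.
by apply: ler_sum => i _; case: (_ <= X).
Qed.

Lemma inv_pow4_le (n k : nat) : (0 < n)%N -> ln n%:R <= k%:R :> R ->
  4 ^- k <= n%:R^-1 :> R.
Proof.
move=> n0 nk; rewrite lef_pV2 ?posrE ?exprn_gt0 ?ltr0n //.
rewrite -ler_ln ?posrE ?exprn_gt0 ?ltr0n // lnXn // -[leRHS]mulr_natl.
apply: le_trans nk _; rewrite ler_peMr //.
have -> : 4 = 2 ^+ 2 :> R by ring.
by rewrite lnXn // -[leRHS]mulr_natl ln_ge_half.
Qed.

End Log.

Section Scale.
Variables (R : realType) (n h : nat) (D : nat -> R) (V : R).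
Hypotheses (n2 : (2 <= n)%N) (h_half : (2 * h <= n)%N) (V_gt0 : 0 < V).
Hypothesis D_ge0 : forall i, (i < h)%N -> 0 <= D i.
Hypothesis D_mono : forall i j, (i <= j < h)%N -> D j <= D i.
Hypothesis V_le : V <= \sum_(i < h) D i ^+ 2.

(** If every allowed index failed, then, with t = 2^-14 V / ln n, the square D_i^2
    would be below t for every i, by monotonicity from the index 0, and below
    2048 t / (i + 1) as soon as k + 1 >= ln n for k = i %/ 2048.  Summing, the first
    4096 ln n indices contribute at most 2^-2 V and the others at most a harmonic
    sum, of total less than V.  Passing from i to i %/ 2048 is what makes the
    allowed indices small compared with n. *)
Lemma good_scale :
  exists2 i, (i < h)%N &
    2 ^- 14 * V <= ln n%:R * (i.+1%:R * D i ^+ 2) /\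
    (i = 0%N \/ (ln n%:R <= i.+1%:R :> R /\ (512 * i.+1 <= n)%N)).
Proof.
set L := ln n%:R; have L_half : 1 <= 2 * L := ln_ge_half R n2.
have L0 : 0 < L by lra.
pose t := 2 ^- 14 * V / L.
have t0 : 0 < t by rewrite divr_gt0 // mulr_gt0 // invr_gt0 exprn_gt0.
have [/existsP[i]|] := boolP [exists i : 'I_h, (t <= i.+1%:R * D i ^+ 2) &&
   ((i == 0%N :> nat) || (L <= i.+1%:R) && (512 * i.+1 <= n)%N)].
  case/andP=> ti good; exists i => //; split; first by rewrite -ler_pdivrMl // mulrC.
  by case/orP: good => [/eqP->|/andP[]]; [left | right].
rewrite negb_exists => /forallP none; suff : \sum_(i < h) D i ^+ 2 < V by rewrite ltNge V_le.
have h0 : (0 < h)%N.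
  by case: (posnP h) V_le => // ->; rewrite big_ord0 leNgt V_gt0.
pose X := 2048 * (2 * L); have X0 : 0 < X by rewrite !mulr_gt0.
have none' k : (k < h)%N -> (k == 0%N) || (L <= k.+1%:R) && (512 * k.+1 <= n)%N ->
    k.+1%:R * D k ^+ 2 < t.
  by move=> kh k_ok; have := none (Ordinal kh); rewrite /= k_ok andbT -ltNge.
have sqD i j : (i <= j < h)%N -> D j ^+ 2 <= D i ^+ 2.
  move=> ij; have /andP[_ jh] := ij; rewrite ler_sqr ?nnegrE ?D_mono ?D_ge0 //.
  by case/andP: ij => ij _; apply: leq_ltn_trans jh.
have term (i : 'I_h) : D i ^+ 2 <= (i.+1%:R <= X)%R%:R * t + 2048 * t * i.+1%:R^-1.
  pose k := (i %/ 2048)%N.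
  have ki : (k <= i)%N by apply: leq_div.
  have kh : (k < h)%N by apply: leq_ltn_trans (ltn_ord i).
  have ik : (i.+1 <= 2048 * k.+1)%N by rewrite mulnC; apply: ltn_ceil.
  have ki' : (2048 * k <= i)%N by rewrite mulnC leq_trunc_div.
  have inv0 : 0 < i.+1%:R^-1 :> R by rewrite invr_gt0 ltr0n.
  have ikR : i.+1%:R <= 2048 * k.+1%:R :> R by rewrite -natrM ler_nat.
  have rest0 : 0 <= 2048 * t * i.+1%:R^-1
    by apply: mulr_ge0 (ltW inv0); rewrite mulr_ge0 // ltW.
  have [iX|Xi] := leP i.+1%:R X.
    have := none' _ h0 isT; rewrite mul1r => /ltW D0; rewrite mul1r.
    by have := sqD 0%N i; rewrite leq0n ltn_ord => /(_ isT) => Di;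
      rewrite (le_trans Di) // (le_trans D0) // lerDl.
  have {}Xi : 2 * L < k.+1%:R by have := lt_le_trans Xi ikR; rewrite ltr_pM2l.
  have Lk : L <= k.+1%:R by apply: le_trans (ltW Xi); rewrite ler_peMl ?ler1n ?ltW.
  have k1 : (0 < k)%N by rewrite -ltnS -(ltr_nat R); apply: le_lt_trans Xi.
  have kn : (512 * k.+1 <= n)%N.
    apply: (@leq_trans (512 * (4 * k))).
      rewrite leq_mul2l /= (@leq_trans (2 * k)) ?leq_mul2r ?orbT //.
      by rewrite mul2n -addnn -addn1 leq_add2l.
    rewrite mulnA; apply: (leq_trans ki'); apply: leq_trans (ltnW (ltn_ord i)) _.
    by apply: leq_trans h_half; rewrite leq_pmull.
  have := none' _ kh; rewrite Lk kn orbT => /(_ isT) Dk.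
  have Di : D i ^+ 2 <= D k ^+ 2 by apply: sqD; rewrite ki ltn_ord.
  rewrite mul0r add0r ler_pdivlMr ?ltr0n //.
  apply: le_trans (_ : D k ^+ 2 * (2048 * k.+1%:R) <= _); last by lra.
  by rewrite ler_pM ?sqr_ge0.
have t2048 : 0 < 2048 * t by rewrite pmulr_rgt0.
apply: le_lt_trans (_ : X * t + 2048 * t * (1 + L) < V).
  apply: le_trans (ler_sum _ (fun i _ => term i)) _; rewrite big_split /=.
  rewrite -mulr_suml -mulr_sumr; apply: lerD.
    by rewrite ler_pM2r //; apply/sum_indic_le/ltW.
  rewrite (ler_pM2l t2048); case: h h0 h_half => // m _ m_half.
  apply: le_trans (harmonic_le_ln R m) _; rewrite lerD2l.
  rewrite ler_ln ?posrE ?ltr0n ?(leq_trans _ n2) //.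
  by rewrite ler_nat (leq_trans _ m_half) // leq_pmull.
have tL : t * L = 2 ^- 14 * V by rewrite /t divfK // gt_eqF.
have -> : X * t + 2048 * t * (1 + L) = 6144 * (t * L) + 2048 * t by rewrite /X; ring.
have t_le : t <= 2 * (t * L) by rewrite mulrCA -[leLHS]mulr1 ler_pM2l.
have : 2 ^- 14 * 10240 < 1 :> R.
  by rewrite mulrC ltr_pdivrMr ?exprn_gt0 // mul1r -natrX ltr_nat.
rewrite -(ltr_pM2r V_gt0) mul1r; apply: le_lt_trans.
rewrite tL in t_le *; move: (2 ^- 14) t_le => c t_le; lra.
Qed.
End Scale.

(** * Sorted values *)

Definition count_between (R : realFieldType) (T : finType) (w y : T -> R)
  (a b : R) : nat :=
  #|[set tau : {perm T} | a <= wsum w y tau <= b]|.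

Lemma count_between_cover (R : realFieldType) (T : finType) (w y : T -> R) (r K : R) :
    (forall a, (count_between w y a (a + r))%:R <= K) ->
  forall m a b, b - a <= r *+ m.+1 -> (count_between w y a b)%:R <= K *+ m.+1.
Proof.
move=> one; elim=> [|m IH] a b ab.
  rewrite mulr1n; apply: le_trans (one a); rewrite ler_nat.
  apply/subset_leq_card/subsetP => tau; rewrite !inE => /andP[-> /le_trans]; apply.
  by rewrite mulr1n in ab; rewrite -lerBlDl.
rewrite mulrS; have ab' : b - (a + r) <= r *+ m.+1.
  by rewrite mulrS in ab; rewrite opprD addrA lerBlDl.
apply: le_trans (lerD (one a) (IH _ _ ab')); rewrite -natrD ler_nat.
apply: leq_trans (leq_card_setU _ _); apply/subset_leq_card/subsetP => tau.
by rewrite !inE => /andP[-> ->]; rewrite andbT /= le_total.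
Qed.

Section Sorted.
Variables (R : realType) (n : nat) (w y : 'I_n -> R) (Dy V : R) (h : 'I_n).
Hypotheses (n2 : (2 <= n)%N) (Dy_gt0 : 0 < Dy) (V_gt0 : 0 < V).
Hypothesis w_mono : forall i j : 'I_n, (i <= j)%N -> w j <= w i.
Hypothesis y_gap : forall p q, y p < y q -> Dy <= y q - y p.
Hypothesis y_inj : injective y.
Hypothesis h_half : (2 * h <= n)%N.
Hypothesis V_le : V <= \sum_(i < n | (i < h)%N) (w i - w h) ^+ 2.

Local Notation P := #|{perm 'I_n}|.

(** The i + 1 largest values against the values from index [h] on: the two groups
    are separated by D_i, and the second contains at least half of all values. *)
Lemma short_interval : exists2 r, 0 < r &
  2 ^- 14 * V * Dy ^+ 2 <= ln n%:R * r ^+ 2 /\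
  forall a, (count_between w y a (a + r))%:R <= 2 ^+ 22 / n%:R * P%:R :> R.
Proof.
(* Indices outside of 'I_n are sent to [h], where the excess is 0. *)
pose D i := w (insubd h i) - w h.
have hn := ltn_ord h.
have val_in i : (i < h)%N -> val (insubd h i) = i.
  by move=> ih; rewrite val_insubd (ltn_trans ih).
have D_ge0 i : (i < h)%N -> 0 <= D i.
  by move=> ih; rewrite subr_ge0 w_mono // val_in // ltnW.
have D_mono i j : (i <= j < h)%N -> D j <= D i.
  case/andP=> ij jh; have ih := leq_ltn_trans ij jh.
  by rewrite lerD2r w_mono // !val_in.
have V_le' : V <= \sum_(i < h) D i ^+ 2.
  rewrite (big_ord_widen n (fun i => D i ^+ 2)) ?(ltnW hn) //.
  by under eq_bigr do rewrite /D valKd.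
have [i ih [ti i_ok]] := good_scale n2 h_half V_gt0 D_ge0 D_mono V_le'.
have n0 : 0 < n%:R :> R by rewrite ltr0n; lia.
have Di0 : 0 < D i.
  rewrite lt_def D_ge0 // andbT; apply/eqP => Di; move: ti.
  by rewrite Di expr0n !mulr0 leNgt mulr_gt0 // invr_gt0 exprn_gt0.
pose A : {set 'I_n} := [set a : 'I_n | (a < i.+1)%N].
pose B : {set 'I_n} := [set b : 'I_n | (h <= b)%N].
have cA : #|A| = i.+1.
  rewrite -sum1_card; under eq_bigl do rewrite inE.
  by rewrite -(big_ord_widen n (fun=> 1%N)) ?sum1_card ?card_ord // (leq_trans ih) // ltnW.
have cB : (#|'I_n| <= 2 * #|B|)%N.
  have cBc : #|~: B| = h.
    rewrite -sum1_card; under eq_bigl do rewrite !inE -ltnNge.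
    by rewrite -(big_ord_widen n (fun=> 1%N)) ?sum1_card ?card_ord // ltnW.
  have := cardsC B; rewrite cBc card_ord => hB.
  by rewrite -(leq_add2r (2 * h)) -mulnDr hB [(2 * n)%N]mul2n -addnn leq_add2l.
have gap a b : a \in A -> b \in B -> D i <= w a - w b.
  rewrite !inE => ai hb; rewrite /D; apply: lerB; apply: w_mono => //.
  by rewrite val_in.
have sq : 2 ^- 14 * V * Dy ^+ 2 <= ln n%:R * (i.+1%:R * (D i * Dy) ^+ 2).
  by have := ler_wpM2r (sqr_ge0 Dy) ti; rewrite exprMn -!mulrA.
case: i_ok => [i0|[Li in_]].
  exists (D i * Dy); first exact: mulr_gt0.
  split=> [|a]; first by move: sq; rewrite i0 mul1r.
  have := two_level_one Di0 Dy_gt0 gap y_gap y_inj cB a;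
  rewrite cA i0 card_ord => /(_ erefl).
  move=> /le_trans; apply; rewrite ler_wpM2r // ler_wpM2r ?invr_ge0 //.
  by rewrite -natrX ler_nat.
pose s : R := Num.sqrt i.+1%:R.
have s2 : s ^+ 2 = i.+1%:R by rewrite sqr_sqrtr.
have s1 : 1 <= s by rewrite -sqrtr1 ler_sqrt // ler1n.
exists (D i * Dy * s); first by rewrite !mulr_gt0 // (lt_le_trans ltr01).
split=> [|a]; first by rewrite [(_ * s) ^+ 2]exprMn s2 [_ * i.+1%:R]mulrC.
have := two_level_many Di0 Dy_gt0 gap y_gap y_inj cB a s1.
rewrite cA card_ord => /(_ s2 in_) /le_trans; apply; rewrite ler_wpM2r //.
have := inv_pow4_le (n := n) (k := i.+1) _ Li; rewrite -(ltr0n R) n0 => /(_ isT) bad.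
apply: le_trans (lerD (lexx _) bad) _; rewrite -[X in _ + X]mul1r -mulrDl.
rewrite ler_wpM2r ?invr_ge0 // [leRHS]exprS mulr_natl mulr2n lerD2l.
by apply: exprn_ege1; rewrite lerDl.
Qed.

(** Covering by intervals of the length [r] of [short_interval], which is at least
    2^-8 sqrt (2 V) Dy / sqrt (ln n). *)
Lemma sorted_concentration a b : a <= b ->
  (count_between w y a b)%:R <= 2 ^+ 30 *
     ((b - a) / (n%:R * Num.sqrt (2 * V) * Dy) * Num.sqrt (ln n%:R) + n%:R^-1)
     * P%:R :> R.
Proof.
move=> ab; have [r r0 [r_large short]] := short_interval.
have n0 : 0 < n%:R :> R by rewrite ltr0n; lia.
pose m := Num.truncn ((b - a) / r).
have L0 : 0 <= b - a by rewrite subr_ge0.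
have /andP[m_le m_gt] : m%:R <= (b - a) / r < m.+1%:R.
  by apply: truncn_itv; rewrite divr_ge0 // ltW.
have cover : b - a <= r *+ m.+1.
  by rewrite -mulr_natr mulrC -ler_pdivrMr // ltW.
apply: le_trans (count_between_cover short cover) _.
rewrite -[leLHS]mulr_natr mulrAC ler_wpM2r //.
have V20 : 0 < Num.sqrt (2 * V) by rewrite sqrtr_gt0 mulr_gt0.
have L1 := ln_ge_half R n2; have Ln0 : 0 < ln n%:R :> R by lra.
set S := Num.sqrt (2 * V); set l := Num.sqrt (ln n%:R).
have l0 : 0 < l by rewrite sqrtr_gt0.
have r_l : S * Dy <= 2 ^+ 8 * (l * r).
  have lhs0 : 0 <= S * Dy by rewrite mulr_ge0 ?(ltW V20) ?(ltW Dy_gt0).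
  have rhs0 : 0 <= 2 ^+ 8 * (l * r)
    by apply: mulr_ge0; [rewrite exprn_ge0 | rewrite mulr_ge0 // ltW].
  rewrite -ler_sqr ?nnegrE // exprMn sqr_sqrtr ?mulr_ge0 ?(ltW V_gt0) //.
  have -> : (2 ^+ 8 * (l * r)) ^+ 2 = 2 * (2 ^+ 15 * (l ^+ 2 * r ^+ 2)) by ring.
  rewrite [l ^+ 2]sqr_sqrtr ?(ltW Ln0) //.
  have c14 : 0 < 2 ^+ 14 :> R by rewrite exprn_gt0.
  move: r_large; rewrite -mulrA ler_pdivrMl // => r_large.
  rewrite -mulrA ler_pM2l //; apply: le_trans r_large _; apply: ler_wpM2r.
    exact: mulr_ge0 (ltW Ln0) (sqr_ge0 _).
  by rewrite [leRHS]exprS ler_peMl ?ler1n // ltW.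
have inv_r : r^-1 <= 2 ^+ 8 * (l / (S * Dy)).
  have SD : 0 < S * Dy by rewrite mulr_gt0.
  by rewrite mulrA ler_pdivlMr // ler_pdivrMl // [leRHS]mulrC -mulrA.
have -> : 2 ^+ 30 * ((b - a) / (n%:R * S * Dy) * l + n%:R^-1)
    = 2 ^+ 30 * ((b - a) * (l / (S * Dy)) + 1) * n%:R^-1.
  by field; rewrite !gt_eqF.
rewrite mulrAC ler_wpM2r ?invr_ge0 //.
have m_le' : m%:R <= (b - a) * (2 ^+ 8 * (l / (S * Dy))).
  by apply: le_trans m_le _; rewrite ler_wpM2l.
set q := (b - a) * (l / (S * Dy)) in m_le' *.
have -> : 2 ^+ 30 * (q + 1) = 2 ^+ 22 * (2 ^+ 8 * q + 2 ^+ 8) :> R by ring.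
rewrite -[m.+1%:R]natr1 ler_pM2l ?exprn_gt0 // lerD //.
  by rewrite (le_trans m_le') // mulrCA.
by apply: exprn_ege1; rewrite ler1n.
Qed.

End Sorted.

(** * Arbitrary values *)

Lemma sort_perm (R : realDomainType) n (w : 'I_n -> R) :
  exists p : 'S_n, forall i j : 'I_n, (i <= j)%N -> w (p j) <= w (p i).
Proof.
have : perm_eq (sort (fun x y : R => y <= x) [tuple w i | i < n]) [tuple w i | i < n].
  by rewrite perm_sort.
move=> /tuple_permP[p sE]; exists p => i j ij.
have srt : sorted (fun x y : R => y <= x) (sort (fun x y : R => y <= x) [tuple w i | i < n]).
  by apply: sort_sorted => x y; apply: le_total.
rewrite sE in srt.
have nthE (k : 'I_n) : nth 0 [tuple tnth [tuple w i | i < n] (p i) | i < n] k = w (p k).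
  by rewrite -tnth_nth !tnth_mktuple.
rewrite -!nthE.
by apply: (sorted_leq_nth _ _ 0 srt) => //; rewrite ?inE ?size_tuple //=
  => x y z yx zy; apply: le_trans yx.
Qed.

Lemma count_between_relabel (R : realFieldType) (T : finType) (w y : T -> R)
    (p : {perm T}) a b :
  count_between (fun x => w (p x)) y a b = count_between w y a b.
Proof.
rewrite /count_between -[RHS](card_preimset _ (mulgI p^-1%g)); apply: eq_card => tau.
rewrite !inE; suff -> : wsum (fun x => w (p x)) y tau = wsum w y (p^-1 * tau)%g by [].
rewrite /wsum [RHS](reindex_inj (@perm_inj _ p)) /=.
by apply: eq_bigr => x _; rewrite permM permK.
Qed.

Lemma count_between_opp (R : realFieldType) (T : finType) (w y : T -> R) a b :
  count_between (fun x => - w x) y (- b) (- a) = count_between w y a b.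
Proof.
apply: eq_card => tau; rewrite !inE.
have -> : wsum (fun x => - w x) y tau = - wsum w y tau.
  by rewrite /wsum -sumrN; apply: eq_bigr => x _; rewrite mulNr.
by rewrite !lerN2 andbC.
Qed.

Lemma variance_le (R : realFieldType) n (w : 'I_n -> R) (M : R) :
  \sum_i (w i - n%:R^-1 * \sum_i w i) ^+ 2 <= \sum_i (w i - M) ^+ 2.
Proof.
case: n w => [|n] w; first by rewrite !big_ord0.
set N : R := n.+1%:R; have N0 : N != 0 by rewrite pnatr_eq0.
set S := \sum_i w i; set mu := N^-1 * S.
have expand c : \sum_i (w i - c) ^+ 2 = \sum_i w i ^+ 2 - 2 * c * S + N * c ^+ 2.
  have -> : N * c ^+ 2 = \sum_(i < n.+1) c ^+ 2 by rewrite sumr_const card_ord mulr_natl.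
  rewrite /S mulr_sumr -sumrB -big_split /=.
  by apply: eq_bigr => i _; ring.
have SE : S = N * mu by rewrite /mu mulVKf.
rewrite !expand -subr_ge0 SE.
set X := _ - _; have -> : X = N * (M - mu) ^+ 2 by rewrite /X; ring.
by rewrite mulr_ge0 ?sqr_ge0 // ler0n.
Qed.

Section Concentration.
Variables (R : realType) (n : nat) (w y : 'I_n -> R) (Dy V : R).
Hypotheses (n2 : (2 <= n)%N) (Dy_gt0 : 0 < Dy) (V_gt0 : 0 < V).
Hypothesis y_gap : forall p q, y p < y q -> Dy <= y q - y p.
Hypothesis y_inj : injective y.
Hypothesis V_le : forall M, 2 * V <= \sum_i (w i - M) ^+ 2.

(** At least half of the squared deviations from a median comes from one side of
    it; the lower side becomes the upper one when the values change sign. *)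
Lemma concentration a b : a <= b ->
  (count_between w y a b)%:R <= 2 ^+ 30 *
     ((b - a) / (n%:R * Num.sqrt (2 * V) * Dy) * Num.sqrt (ln n%:R) + n%:R^-1)
     * #|{perm 'I_n}|%:R :> R.
Proof.
move=> ab; have [p w_mono] := sort_perm w.
have hn : (n./2 < n)%N by lia.
pose h := Ordinal hn; pose w1 i := w (p i).
have V_le1 : 2 * V <= \sum_i (w1 i - w1 h) ^+ 2.
  by apply: le_trans (V_le (w1 h)) _; rewrite (reindex_inj (@perm_inj _ p)).
have split_h : \sum_i (w1 i - w1 h) ^+ 2
    = \sum_(i < n | (i < h)%N) (w1 i - w1 h) ^+ 2
      + \sum_(i < n | (h < i)%N) (w1 i - w1 h) ^+ 2.
  rewrite (bigID (fun i : 'I_n => (i < h)%N)) /=; congr (_ + _).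
  rewrite (bigD1 h) /= ?ltnn // subrr expr0n add0r; apply: eq_bigl => i.
  by rewrite -leqNgt -val_eqE /= ltn_neqAle eq_sym andbC.
have [upper|lower] := leP V (\sum_(i < n | (i < h)%N) (w1 i - w1 h) ^+ 2).
  rewrite -(count_between_relabel w y p).
  apply: (@sorted_concentration R n w1 y Dy V h) => //.
  by rewrite /h /=; lia.
pose w2 i := - w1 (rev_ord i).
have w2E : count_between w y a b = count_between w2 y (- b) (- a).
  rewrite count_between_opp -(count_between_relabel w y p).
  rewrite -(count_between_relabel _ y (perm (@rev_ord_inj n))).
  by apply: eq_card => tau; rewrite !inE /wsum; under eq_bigr do rewrite permE.
have -> : b - a = - a - - b by ring.
rewrite w2E; apply: (@sorted_concentration R n w2 y Dy V (rev_ord h)); rewrite ?lerN2 //.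
- by move=> i j ij; rewrite lerN2 w_mono //= leq_sub2l.
- by rewrite /h /=; lia.
rewrite (reindex_inj rev_ord_inj) /=.
apply: le_trans (_ : _ <= \sum_(i < n | (h < i)%N) (w1 i - w1 h) ^+ 2) _; first by lra.
rewrite le_eqVlt; apply/orP; left; apply/eqP; apply: eq_big => i.
  by have := ltn_ord i; rewrite /h /=; lia.
by move=> _; rewrite /w2 !rev_ordK; ring.
Qed.

End Concentration.

(* [col_perm pi w] is w_pi: its i-th entry is [w 0 (pi i)]. *)
Theorem corollary1p6 (R : realType) :
  exists C : R, 0 < C /\
    forall (n : nat) (w v : 'rV[R]_n),
      (2 <= n)%N -> 0 < Delta v -> 0 < sigma w ->
      forall a b : R, a <= b ->
        uniform_prob R (fun pi : 'S_n => dot (col_perm pi w) v \in `[a, b])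
        <= C * ((b - a) / (n%:R * sigma w * Delta v) * Num.sqrt (ln n%:R)
                + n%:R^-1).
Proof.
exists (2 ^+ 30); split; first by rewrite exprn_gt0.
move=> n w v n2 Dv sw a b ab.
have P0 : 0 < #|{perm 'I_n}|%:R :> R.
  by rewrite ltr0n; apply/card_gt0P; exists 1%g.
rewrite /uniform_prob ler_pdivrMr //.
have [_ D_le] := Delta_is_min v n2.
have y_inj : injective (fun i => v 0 i).
  move=> i j vij; apply/eqP; apply: contraTT (Dv) => ij.
  by rewrite -leNgt (le_trans (D_le i j ij)) // vij subrr normr0.
have y_gap i j : v 0 i < v 0 j -> Delta v <= v 0 j - v 0 i.
  move=> lt_ij; have ji : j != i by apply: contraTneq lt_ij => ->; rewrite ltxx.
  by rewrite (le_trans (D_le _ _ ji)) // gtr0_norm // subr_gt0.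
pose V := sigma w ^+ 2 / 2.
have V2 : 2 * V = sigma w ^+ 2 by rewrite /V; field.
have V0 : 0 < V by rewrite divr_gt0 // exprn_gt0.
have sE : Num.sqrt (2 * V) = sigma w by rewrite V2 sqrtr_sqr gtr0_norm.
have V_le M : 2 * V <= \sum_i (w 0 i - M) ^+ 2.
  rewrite V2 /sigma sqr_sqrtr; last by apply: sumr_ge0 => i _; apply: sqr_ge0.
  exact: variance_le.
have := concentration n2 Dv V0 y_gap y_inj V_le ab; rewrite sE.
(* The sum is written along the inverse of [pi], which is again uniform. *)
congr (_%:R <= _); rewrite /count_between -[LHS](card_preimset _ invg_inj).
apply: eq_card => pi; rewrite inE [LHS]inE unfold_in /= in_itv /=.
suff -> : wsum (fun i => w 0 i) (fun i => v 0 i) pi^-1%g = dot (col_perm pi w) v by [].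
rewrite /wsum /dot (reindex_inj (@perm_inj _ pi)) /=.
by apply: eq_bigr => i _; rewrite permK mxE.
Qed.
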